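(* Let $(\Gamma, v, w)$ be a twice-marked graph of genus $g$ with $0$-general transmission. Then $\Gamma$ is Brill--Noether general in the following sense: for every divisor $D$ of degree $d$ on $\Gamma$, if $r = r(D)$ and $D$ has vanishing sequences $(a_i)_{i=0}^r$ at $v$ and $(b_i)_{i=0}^r$ at $w$, then the adjusted Brill--Noether number is nonnegative: $$\rho = g - (r+1)(g-d+r) - \sum_{i=0}^r (a_i - i) - \sum_{i=0}^r (b_i - i) \geq 0.$$
   Context: Graphs. The word ''graph'' means either a connected metric graph, or a finite connected graph (parallel edges allowed) with no loop edges; ''points'' are all points of a metric graph, respectively the vertices of a finite graph. A divisor is a $\mathbb{Z}$-linear combination of points; it is effective if all coefficients are nonnegative. Linear equivalence $\sim$ is the usual one (chip-firing for finite graphs; differing by the divisor of a continuous piecewise-linear function with integer slopes for metric graphs). $r(D)$ is the Baker--Norine rank: $r(D) = -1$ if $D$ is not equivalent to an effective divisor, and otherwise $r(D)$ is the largest $r \ge 0$ such that $D - E$ is equivalent to an effective divisor for every effective $E$ of degree $r$. The genus $g$ is the first Betti number, and $K_\Gamma=\sum_p (\mathrm{val}(p)-2)p$ is the canonical divisor. A twice-marked graph $(\Gamma, v, w)$ is a graph with two chosen points. Vanishing sequence. The vanishing sequence of a divisor $D$ at a point $u$ is the sequence $(a_i)_{0 \leq i \leq r(D)}$ defined by $a_i = \max\{a \in \mathbb{Z} : r(D - au) \geq r(D) - i\}$. Submodularity. For a divisor $D$ on $(\Gamma, v, w)$ put $\Delta(D) = r(D) - r(D-v) - r(D-w) + r(D-v-w)$.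 $D$ is submodular (with respect to $v,w$) if $\Delta(D + av - bw) \geq 0$ for all $a,b \in \mathbb{Z}$. Transmission permutation. The transmission permutation of $D$ on $(\Gamma, v, w)$, if it exists, is the unique permutation $\tau^{v,w}_D : \mathbb{Z} \to \mathbb{Z}$ such that the following two (equivalent) equations hold for all $a, b \in \mathbb{Z}$: $r(D + av - bw) + 1 = \#\{ n \geq b : \tau^{v,w}_D(n) \leq a\}$ and $r(K_\Gamma - D - av + bw) + 1 = \#\{ n < b : \tau^{v,w}_D(n) > a \}$. It exists exactly when $D$ is submodular. $0$-general transmission. An inversion of a permutation $\alpha$ of $\mathbb{Z}$ is a pair $(x,y)\in\mathbb{Z}^2$ with $x<y$ and $\alpha(x) > \alpha(y)$; $\operatorname{inv}_0(\alpha)$ is the number of inversions, and $\widetilde{\Sigma}_0$ is the group of permutations of $\mathbb{Z}$ with finitely many inversions. A genus-$g$ twice-marked graph $(\Gamma, v, w)$ has $0$-general transmission if every divisor $D$ on $\Gamma$ is submodular and satisfies $\tau^{v,w}_D \in \widetilde{\Sigma}_0$ and $\operatorname{inv}_0(\tau^{v,w}_D) \leq g$. *)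

(* Defs.v *)
From HB Require Import structures.
From mathcomp Require Import all_boot all_order all_algebra.
From mathcomp Require Import finmap freeg.
From mathcomp Require Import boolp classical_sets functions cardinality reals.

Set Implicit Arguments.
Unset Strict Implicit.
Unset Printing Implicit Defensive.

Import Order.TTheory GRing.Theory Num.Theory.

Local Open Scope classical_set_scope.
Local Open Scope ring_scope.

(* Loops and parallel edges are allowed. The orientation of each edge is
   auxiliary. *)
Record multigraph := Multigraph {
  vertex : finType;
  edge : finType;
  src : edge -> vertex;
  tgt : edge -> vertex
}.

Definition adjacent (G : multigraph) : rel (vertex G) := fun x y =>
  [exists e : edge G, ((src e == x) && (tgt e == y))
                   || ((src e == y) && (tgt e == x))].

(* Nonemptiness is not required here: it follows from the presence of marked
   points. *)
Definition connected_graph (G : multigraph) : Prop :=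
  forall x y : vertex G, connect (@adjacent G) x y.

(* A loop contributes 2. *)
Definition degree (G : multigraph) (x : vertex G) : nat :=
  (#|[pred e : edge G | src e == x]| + #|[pred e : edge G | tgt e == x]|)%N.

(* The simplicial boundary map C_1(G; Q) -> C_0(G; Q), acting on row vectors. *)
Definition boundary_mx (G : multigraph) : 'M[rat]_(#|edge G|, #|vertex G|) :=
  \matrix_(i, j) ((tgt (enum_val i) == enum_val j)%:R
                  - (src (enum_val i) == enum_val j)%:R).

(* dim H_1(G; Q), which is also the first Betti number of every geometric
   realization of G. *)
Definition betti1 (G : multigraph) : nat := \rank (kermx (boundary_mx G)).

Record finite_graph := FiniteGraph {
  fin_graph :> multigraph;
  fin_connected : connected_graph fin_graph;
  fin_loopless : forall e : edge fin_graph, src e != tgt e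
}.

(* A metric graph is given by a model: a finite connected multigraph together
   with a length for each edge; e is identified with the segment [0, len e],
   running from src e to tgt e. *)
Record metric_graph (R : realType) := MetricGraph {
  model :> multigraph;
  len : edge model -> R;
  len_gt0 : forall e, 0 < len e;
  met_connected : connected_graph model
}.

Section FinitePrincipal.
Variable G : finite_graph.

(* The effect of the firing script f; f = 1 at x and 0 elsewhere fires x. *)
Definition laplacian (f : vertex G -> int) (x : vertex G) : int :=
  \sum_(e : edge G | src e == x) (f x - f (tgt e))
  + \sum_(e : edge G | tgt e == x) (f x - f (src e)).

Definition fin_lin_equiv (D D' : {freeg (vertex G)}) : Prop :=
  exists f : vertex G -> int,
    forall x, coeff x D - coeff x D' = laplacian f x.

Definition fin_canonical : {freeg (vertex G)} :=
  \sum_(x : vertex G) << ((degree x)%:Z - 2) *g x >>.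

End FinitePrincipal.

Section MetricPrincipal.
Variables (R : realType) (G : metric_graph R).

Definition metric_point : choiceType :=
  (vertex G + {e : edge G & {t : R | 0 < t < len e}})%type.

(* The parametrization [0, len e] -> Gamma of the closed edge e (extended to R
   by constants). *)
Definition chart (e : edge G) (t : R) : metric_point :=
  if insub t is Some u
  then inr (Tagged (fun e => {t : R | 0 < t < len e}) (u : {t : R | 0 < t < len e}))
  else inl (if t <= 0 then src e else tgt e).

(* h is piecewise linear on [0, l] with integer slopes; since the pieces are
   closed intervals, h is continuous there. *)
Definition int_piecewise_linear (l : R) (h : R -> R) : Prop :=
  exists (n : nat) (t : nat -> R),
    [/\ t 0%N = 0, t n = l, (forall i, (i < n)%N -> t i < t i.+1)
      & forall i, (i < n)%N -> exists s : int, forall x,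
          t i <= x <= t i.+1 -> h x = h (t i) + s%:~R * (x - t i)].

Definition rational_function (f : metric_point -> R) : Prop :=
  forall e : edge G, int_piecewise_linear (len e) (fun t => f (chart e t)).

(* The right slope of h at 0, for h linear with integer slope on some
   [0, eps). *)
Definition initial_slope (h : R -> R) : int :=
  xget 0 [set s : int | exists2 eps : R, 0 < eps &
            forall u, 0 <= u < eps -> h u = h 0 + s%:~R * u].

(* The sum of the slopes of f along the outgoing tangent directions at p. *)
Definition ord_at (f : metric_point -> R) (p : metric_point) : int :=
  match p with
  | inl x =>
      \sum_(e : edge G | src e == x) initial_slope (fun u => f (chart e u))
      + \sum_(e : edge G | tgt e == x)
          initial_slope (fun u => f (chart e (len e - u)))
  | inr (existT e t) =>
      initial_slope (fun u => f (chart e (val t + u)))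
      + initial_slope (fun u => f (chart e (val t - u)))
  end.

Definition met_lin_equiv (D D' : {freeg metric_point}) : Prop :=
  exists2 f : metric_point -> R, rational_function f &
    forall p, coeff p D - coeff p D' = ord_at f p.

(* Interior points of edges have valence 2, hence coefficient 0. *)
Definition met_canonical : {freeg metric_point} :=
  \sum_(x : vertex G) << ((degree x)%:Z - 2) *g (inl x : metric_point) >>.

End MetricPrincipal.

Variant graph (R : realType) :=
  | Finite of finite_graph
  | Metric of metric_graph R.

Section Graph.
Variables (R : realType) (G : graph R).

Definition point : choiceType :=
  match G with
  | Finite G => vertex G
  | Metric G => metric_point G
  end.

Definition divisor := {freeg point}.

Definition genus : nat :=
  match G with
  | Finite G => betti1 G
  | Metric G => betti1 G
  end.

End Graph.

Definition lin_equiv (R : realType) (G : graph R) :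
    divisor G -> divisor G -> Prop :=
  match G return divisor G -> divisor G -> Prop with
  | Finite G => @fin_lin_equiv G
  | Metric G => @met_lin_equiv R G
  end.

Definition canonical (R : realType) (G : graph R) : divisor G :=
  match G return divisor G with
  | Finite G => fin_canonical G
  | Metric G => met_canonical G
  end.

(* The greatest element of A (0 if there is none). *)
Definition zmax (A : set int) : int :=
  xget 0 [set m | A m /\ forall a, A a -> a <= m].

Definition has_card (T : choiceType) (A : set T) (n : int) : Prop :=
  finite_set A /\ #|` fset_set A|%:Z = n.

Section BrillNoether.
Variables (R : realType) (G : graph R).
Implicit Types (D E : divisor G) (u v w : point G) (tau : int -> int).

Definition effective D : Prop := forall p, 0 <= coeff p D.

Definition equiv_effective D : Prop :=
  exists2 E, effective E & lin_equiv D E.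

(* The Baker--Norine rank. *)
Definition rank D : int :=
  if `[< equiv_effective D >] then
    zmax [set r : int | 0 <= r /\
            forall E, effective E -> deg E = r -> equiv_effective (D - E)]
  else -1.

(* The maximum exists for i <= rank D only. *)
Definition vanishing D u (i : nat) : int :=
  zmax [set a : int | rank D - i%:Z <= rank (D - << a *g u >>)].

Definition twist v w D (a b : int) : divisor G :=
  D + << a *g v >> - << b *g w >>.

Definition submodular v w D : Prop :=
  forall a b : int, let D' := twist v w D a b in
    0 <= rank D' - rank (D' - << v >>) - rank (D' - << w >>)
         + rank (D' - << v >> - << w >>).

Definition transmission_permutation v w D tau : Prop :=
  [/\ bijective tau,
      forall a b : int,
        has_card [set n : int | b <= n /\ tau n <= a]
                 (rank (twist v w D a b) + 1)
    & forall a b : int,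
        has_card [set n : int | n < b /\ a < tau n]
                 (rank (canonical G - D - << a *g v >> + << b *g w >>) + 1)].

Definition inversions tau : set (int * int) :=
  [set p | p.1 < p.2 /\ tau p.2 < tau p.1].

Definition inv0 tau : nat := #|` fset_set (inversions tau)|.

Definition zero_general_transmission v w : Prop :=
  forall D, submodular v w D /\
    exists tau, [/\ transmission_permutation v w D tau,
                    finite_set (inversions tau) & (inv0 tau <= genus G)%N].

End BrillNoether.

(* Main.v *)
From mathcomp Require Import all_boot all_order all_algebra.
From mathcomp Require Import finmap freeg.
From mathcomp Require Import boolp classical_sets cardinality reals.
From mathcomp Require Import zify ring lra.
Require Import Defs.

Set Implicit Arguments.
Unset Strict Implicit.
Unset Printing Implicit Defensive.

Import Order.TTheory GRing.Theory Num.Theory.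

Local Open Scope classical_set_scope.
Local Open Scope ring_scope.

(** Let tau be the transmission permutation of D, and put A = {n >= 0 :
    tau n <= 0} and B = {m < 0 : tau m > 0}, so that #A = r + 1.  Every pair in
    B * A is an inversion of tau.  More inversions (m, n) with n in A come from
    the vanishing sequences.  The terms of the sequence at w are the elements
    of A and those of the sequence at v are the numbers -tau n, n in A, each
    listed increasingly; so the sum of the b_i - i counts the pairs (m, n) with
    0 <= m < n, n in A and m not in A, and the sum of the a_i - i counts the
    pairs of values tau n < k <= 0 with n in A and k not in tau(A).  In the
    first case tau m > 0, in the second the preimage of k is negative, so both
    give inversions, distinct from each other and from those in B * A
    (gaps_le_inv0).  Since tau has at most g inversions, it remains to see that
    #B >= g - d + r.

    By Riemann--Roch this would be an equality, but the inequality is enough,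
    and the permutation itself provides it once Riemann's upper bound
    r(D + a v) <= d + a - g is known for large a (eventually_rank_le): the
    a values 1, ..., a of tau are taken at a points, of which at most #B are
    negative, so r(D + a v) + 1 >= r + 1 + a - #B (riemann_bound).

    Riemann's upper bound follows from one divisor nu of degree at least g - 1
    that is not equivalent to an effective divisor.  Indeed the transmission
    permutation of D - nu shows that D + a v - nu is equivalent to some
    effective E when a is large; if r(D + a v) >= deg E then D + a v - E, hence
    also nu, would be equivalent to an effective divisor (rank_lt_deg_sub).
    On a finite graph nu is the divisor of an acyclic orientation
    (orientation_divisor_noneffective); on a metric graph it is the sum of
    the midpoints of the edges minus the sum of the vertices
    (midpoint_divisor_noneffective).  Both have degree #edges - #vertices, which
    is at least g - 1 by connectedness (betti1_le).

    This uses that linear equivalence preserves degrees and is compatible with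
    subtraction.  For metric graphs the former holds because the divisor of a
    function is the boundary of the 1-chain of its slopes (ord_at_pieces), and
    the latter because, by compactness, a function on a segment is piecewise
    linear as soon as it is linear on both sides of every point
    (int_piecewise_linear_of_germs). *)

(** * Gaps of finite sets of integers *)

Lemma has_card_seq (A : set int) (n : int) : has_card A n ->
  exists s : seq int, [/\ uniq s, (forall x : int, x \in s <-> A x) & n = size s].
Proof.
case=> finA <-; exists (fset_set A); split=> [|x|//]; first exact: fset_uniq.
by rewrite in_fset_set // inE.
Qed.

Lemma has_card_size (A : set int) (n : int) (s : seq int) :
  has_card A n -> uniq s -> (forall x : int, x \in s <-> A x) -> n = size s.
Proof.
move=> /has_card_seq[t [ut tA ->]] us sA.
rewrite (@uniq_size_uniq _ s t us) in ut; first by rewrite (eqP ut).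
by move=> x; apply/idP/idP => [/sA/tA|/tA/sA].
Qed.

Lemma zmax_eq (A : set int) (m : int) :
  A m -> (forall a, A a -> a <= m) -> zmax A = m.
Proof.
move=> Am mA; apply: xget_unique => // y [Ay yA].
by apply/eqP; rewrite eq_le mA //= yA.
Qed.

Lemma count_ge_sorted (s : seq nat) (i : nat) (c : int) :
  sorted ltn s -> (i < size s)%N ->
  (size s - i <= count (fun x : nat => (c <= x%:Z)%R) s)%N = (c <= (nth 0%N s i)%:Z).
Proof.
move=> ss lt_i; have mono := sorted_ltn_nth ltn_trans 0%N ss.
have lemono j k : (j <= k)%N -> (k < size s)%N -> (nth 0%N s j <= nth 0%N s k)%N.
  rewrite leq_eqVlt => /predU1P[->//|jk] ks; apply/ltnW/mono => //.
  by rewrite inE (ltn_trans jk).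
case: (lerP c) => [le_c|lt_c]; apply/idP.
  rewrite -{2}(cat_take_drop i s) count_cat -size_drop.
  apply: leq_trans (leq_addl _ _); rewrite leq_eqVlt eq_sym -all_count.
  apply/orP; left; apply/(all_nthP 0%N) => j.
  rewrite size_drop ltn_subRL nth_drop => jlt.
  by apply: le_trans le_c _; rewrite lez_nat lemono ?leq_addr.
apply/negP; rewrite -ltnNge -{1}(cat_take_drop i.+1 s) count_cat.
rewrite (eq_in_count (a2 := pred0)) ?count_pred0 ?add0n.
  by apply: leq_ltn_trans (count_size _ _) _; rewrite size_drop; lia.
move=> x /(nthP 0%N)[j]; rewrite size_takel // => lt_j <-.
rewrite nth_take //; apply/negbTE; rewrite -ltNge.
by apply: le_lt_trans lt_c; rewrite lez_nat lemono.
Qed.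

(** Summed over the entries of a sequence [s] without repetition, this is the sum of
    the differences between the sorted entries of [s] and their positions. *)
Definition gap (s : seq nat) (x : nat) : nat :=
  count (fun k => k \notin s) (iota 0 x).

(** Of the [nth 0 s i] numbers below [nth 0 s i], those in [s] are among the first
    [i] entries. *)
Lemma nth_sorted_gap (s : seq nat) (i : nat) :
  sorted ltn s -> (i < size s)%N ->
  (nth 0%N s i <= i + gap s (nth 0 s i))%N.
Proof.
move=> ss lt_i; set x := nth 0%N s i.
rewrite -{1}(size_iota 0 x) -(count_predC (mem s)) leq_add2r.
rewrite -size_filter -(size_takel (ltnW lt_i)).
apply: uniq_leq_size => [|y]; first by rewrite filter_uniq ?iota_uniq.
rewrite mem_filter mem_iota add0n => /andP[/= ys lt_y].
have lt_iy : (index y s < i)%N.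
  rewrite ltnNge; apply/negP => le_i; move: lt_y.
  rewrite ltnNge /x -[leqRHS](nth_index 0%N ys).
  move: le_i; rewrite leq_eqVlt => /predU1P[->|le_i]; first by rewrite leqnn.
  by rewrite ltnW // (sorted_ltn_nth ltn_trans 0%N ss) ?inE ?index_mem.
by rewrite -(nth_index 0%N ys) -(nth_take 0%N lt_iy) mem_nth // size_takel // ltnW.
Qed.

(** Applied to [F a = r(D - a u)], the set on the left is the one whose maximum
    defines the vanishing sequence.  Only for [a >= 0] is [F a] given by counting in
    [s]; this determines the maximum, which is nonnegative. *)
Lemma zmax_count_ge (s : seq nat) (F : int -> int) (i : nat) :
  sorted ltn s -> (i < size s)%N ->
  (forall a : int, 0 <= a -> F a + 1 = count (fun x : nat => a <= x%:Z) s) ->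
  zmax [set a | F 0 - i%:Z <= F a] = nth 0%N s i.
Proof.
move=> ss lt_i Fs.
have F0 : F 0 + 1 = size s.
  by rewrite Fs // -count_predT; congr Posz; apply: eq_count.
have FE (a : int) : 0 <= a -> (F 0 - i%:Z <= F a) = (a <= (nth 0%N s i)%:Z).
  by move=> a0; rewrite -count_ge_sorted //; move: (Fs a a0); lia.
apply: zmax_eq => [|a] /=; first by rewrite FE.
case: (lerP 0 a) => [a0|a_lt0 _]; first by rewrite FE.
exact: le_trans (ltW a_lt0) _.
Qed.

Lemma sum_zmax_count_le (K : seq nat) (F : int -> int) :
  uniq K ->
  (forall a : int, 0 <= a -> F a + 1 = count (fun x : nat => a <= x%:Z) K) ->
  \sum_(0 <= i < size K) (zmax [set a | F 0 - i%:Z <= F a] - i%:Z)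
    <= (\sum_(x <- K) gap K x)%N.
Proof.
move=> uK FK; set s := sort leq K.
have Ks : perm_eq s K by rewrite perm_sort.
have ss : sorted ltn s by rewrite ltn_sorted_uniq_leq sort_uniq uK sort_sorted.
have gapE : gap K =1 gap s.
  by move=> x; apply: eq_count => k; rewrite (perm_mem Ks).
rewrite -(perm_size Ks) (eq_bigr _ (fun x _ => gapE x)).
rewrite -(perm_big _ Ks) /= [in leRHS](big_nth 0%N) -natz rmorph_sum /=.
rewrite big_nat_cond [leRHS]big_nat_cond.
apply: ler_sum => i; rewrite andbT => /andP[_ lt_i].
rewrite (zmax_count_ge ss lt_i) => [|a /FK->]; last by rewrite (permP Ks).
by have := nth_sorted_gap ss lt_i; lia.
Qed.

(** * Counting inversions *)

(** To each [n] in [A] are attached three disjoint sets of [m] that form an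
    inversion with it: [B], the preimages [U n] of the values in the interval from
    [tau n] to [0] that are not attained on [A], which are negative, and the
    nonnegative numbers [V n] below [n] outside [A]. *)
Lemma gaps_le_inv0 (tau : int -> int) (A B : seq int) :
  bijective tau -> finite_set (inversions tau) -> uniq A -> uniq B ->
  (forall n : int, n \in A <-> 0 <= n /\ tau n <= 0) ->
  (forall n : int, n \in B <-> n < 0 /\ 0 < tau n) ->
  (size A * size B + \sum_(n <- A) gap [seq absz (tau m) | m <- A] (absz (tau n))
     + \sum_(n <- A) gap [seq absz m | m <- A] (absz n) <= inv0 tau)%N.
Proof.
move=> tau_bij finI uA uB memA memB; have [tinv tauK tinvK] := tau_bij.
pose S := [seq absz (tau n) | n <- A]; pose T := [seq absz n | n <- A].
pose U n := [seq tinv (- k%:Z) | k <- iota 0 (absz (tau n)) & k \notin S].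
pose V n := [seq k%:Z | k <- iota 0 (absz n) & k \notin T].
pose P := [seq (m, n) | n <- A, m <- B ++ U n ++ V n].
have memU n m : n \in A -> m \in U n -> m < 0 /\ tau n < tau m <= 0.
  move=> /memA[n0 tn] /mapP[k]; rewrite mem_filter mem_iota => /andP[kS lt_k] ->.
  rewrite tinvK; split; last by lia.
  rewrite ltNge; apply: contra kS => m0; apply/mapP.
  by exists (tinv (- k%:Z)); [apply/memA|]; rewrite tinvK //; lia.
have memV n m : n \in A -> m \in V n -> 0 <= m < n /\ 0 < tau m.
  move=> /memA[n0 tn] /mapP[k]; rewrite mem_filter mem_iota => /andP[kT lt_k] ->.
  split; first by lia.
  rewrite ltNge; apply: contra kT => m0; apply/mapP.
  by exists k%:Z => //; apply/memA.
have uP : uniq P.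
  apply: (allpairs_uniq_dep (f := fun n m : int => (m, n))) => // [n nA|].
    rewrite !cat_uniq uB !map_inj_uniq ?filter_uniq ?iota_uniq //=.
    - rewrite andbT; apply/andP; split; apply/hasPn => m; last first.
        by move=> /(memV _ _ nA)[m0 _]; apply/negP => /(memU _ _ nA)[]; lia.
      rewrite mem_cat => /orP[/(memU _ _ nA)|/(memV _ _ nA)] [m0 tm];
        by apply/negP => /memB[]; lia.
    - by move=> k l [].
    - by move=> k l /(can_inj tinvK)/eqP; rewrite eqr_opp => /eqP[].
  by move=> [n m] [n' m'] _ _ /= [-> ->].
have sPI : {subset P <= fset_set (inversions tau)}.
  move=> _ /allpairsPdep[n [m [nA + ->]]]; rewrite in_fset_set // inE /inversions /=.
  have /memA[n0 tn] := nA.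
  rewrite !mem_cat => /or3P[/memB|/(memU _ _ nA)|/(memV _ _ nA)] [m0 tm]; lia.
have := uniq_leq_size uP sPI; apply: leq_trans.
rewrite size_allpairs_dep sumnE !big_map.
rewrite [leqRHS](eq_bigr (fun n => size B + (gap S (absz (tau n)) + gap T (absz n)))%N).
  by rewrite !big_split /= big_const_seq count_predT iter_addn_0 mulnC addnA.
by move=> n _; rewrite !size_cat !size_map !size_filter.
Qed.

(** * The first Betti number *)

(** The kernel of the transposed boundary map consists of the functions on vertices that
    agree at the ends of every edge.  On a connected graph these are constant. *)
Lemma betti1_le (G : multigraph) (x0 : vertex G) : connected_graph G ->
  (betti1 G + #|vertex G| <= #|edge G| + 1)%N.
Proof.
move=> conG; set d := boundary_mx G.
have coker_d : (\rank (kermx d^T) <= 1)%N.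
  apply: leq_trans (rank_leq_row (const_mx 1 : 'rV[rat]_#|vertex G|)).
  apply/mxrankS/rV_subP => u /sub_kermxP ud0.
  pose f x := u 0 (enum_rank x).
  have f_edge e : f (src e) = f (tgt e).
    have /eqP := congr1 (fun c : 'rV[rat]_#|edge G| => c 0 (enum_rank e)) ud0.
    have pick y : \sum_j u 0 j * (y == enum_val j)%:R = f y.
      rewrite (bigD1 (enum_rank y)) //= enum_rankK eqxx mulr1 big1 ?addr0 // => j.
      by rewrite -(inj_eq enum_val_inj) enum_rankK eq_sym => /negbTE->; rewrite mulr0.
    rewrite !mxE (eq_bigr (fun j => u 0 j * (tgt e == enum_val j)%:R
                                    - u 0 j * (src e == enum_val j)%:R)).
      by rewrite sumrB !pick subr_eq0 => /eqP.
    by move=> j _; rewrite !mxE enum_rankK mulrBr.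
  have f_const x : f x = f x0.
    have /connectP[p + ->] := conG x x0.
    elim: p x => //= y p IHp x /andP[/existsP[e He] /IHp <-].
    by case/orP: He => /andP[/eqP<- /eqP<-].
  suff -> : u = f x0 *: const_mx 1 by rewrite scalemx_sub.
  apply/rowP => j; rewrite !mxE mulr1 -(f_const (enum_val j)).
  by rewrite /f enum_valK.
move: coker_d (rank_leq_row d); rewrite /betti1 !mxrank_ker mxrank_tr -/d; lia.
Qed.

Lemma sum_incident (I J : finType) (V : nmodType) (k : I -> J) (F : J -> I -> V) :
  \sum_j \sum_(i | k i == j) F j i = \sum_i F (k i) i.
Proof.
rewrite (exchange_big_dep xpredT) //=; apply: eq_bigr => i _.
by rewrite (big_pred1 (k i)) // => j; rewrite eq_sym.
Qed.

(** * Finite graphs *)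

Section FiniteGraph.
Variable G : finite_graph.
Implicit Types (D E C : {freeg (vertex G)}).

Lemma deg_fin_sum D : deg D = \sum_(x : vertex G) coeff x D.
Proof.
have {1}-> : D = \sum_(x : vertex G) << coeff x D *g x >>.
  apply/eqP/freeg_eqP => y; rewrite raddf_sum (bigD1 y) //= coeffU eqxx mulr1.
  by rewrite big1 ?addr0 // => x /negbTE neq; rewrite coeffU neq mulr0.
by rewrite raddf_sum; apply: eq_bigr => x _ /=; rewrite degU.
Qed.

Lemma sum_laplacian (f : vertex G -> int) : \sum_x laplacian f x = 0.
Proof.
rewrite big_split /= !sum_incident -big_split big1 //= => e _.
by rewrite addrC subrKA subrr.
Qed.

Lemma fin_lin_equiv_deg D C : fin_lin_equiv D C -> deg D = deg C.
Proof.
case=> f Hf; apply/eqP; rewrite -subr_eq0 -degB deg_fin_sum.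
apply/eqP; rewrite -[RHS](sum_laplacian f).
by apply: eq_bigr => x _; rewrite -Hf coeffB.
Qed.

Lemma fin_lin_equivB D D' C C' : fin_lin_equiv D D' -> fin_lin_equiv C C' ->
  fin_lin_equiv (D - C) (D' - C').
Proof.
case=> f Hf [g Hg]; exists (fun x => f x - g x) => x.
have -> : laplacian (fun y => f y - g y) x = laplacian f x - laplacian g x.
  rewrite /laplacian opprD addrACA -!sumrB.
  by congr (_ + _); apply: eq_bigr => e _; ring.
by rewrite -Hf -Hg !coeffB; ring.
Qed.

(** Edges are oriented from the smaller to the larger end in the enumeration of the
    vertices, which makes the orientation acyclic. *)
Definition upper_end (e : edge G) : vertex G :=
  if (enum_rank (src e) < enum_rank (tgt e))%N then tgt e else src e.

(** Its coefficient at a vertex is the indegree minus one. *)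
Definition orientation_divisor : {freeg (vertex G)} :=
  \sum_(e : edge G) << upper_end e >> - \sum_(x : vertex G) << x >>.

Lemma deg_orientation_divisor :
  deg orientation_divisor = #|edge G|%:Z - #|vertex G|%:Z.
Proof.
rewrite degB; congr (_ - _); rewrite raddf_sum.
all: by rewrite (eq_bigr (fun=> 1)) ?sumr_const ?natz // => *; rewrite /= degU.
Qed.

(** The indegree is split as [laplacian] is.  In the absence of loops no edge is
    counted twice. *)
Lemma coeff_orientation_divisor x :
  coeff x orientation_divisor
    = \sum_(e : edge G | src e == x) (upper_end e == x)%:Z
      + \sum_(e : edge G | tgt e == x) (upper_end e == x)%:Z - 1.
Proof.
rewrite coeffB; congr (_ - _); rewrite raddf_sum /=; last first.
  rewrite (bigD1 x) //= coeffU eqxx big1 // => y /negbTE neq.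
  by rewrite coeffU neq mulr0.
rewrite (bigID (fun e => src e == x)) /=; congr (_ + _).
  by apply: eq_bigr => e _; rewrite coeffU mul1r natz.
rewrite [RHS](bigID (fun e => src e == x)) /= [X in _ = X + _]big1 ?add0r.
  rewrite big_mkcond [RHS]big_mkcond /=; apply: eq_bigr => e _.
  rewrite coeffU mul1r natz /upper_end.
  case: (src e =P x) => [->|]; rewrite ?andbF //=.
  by rewrite andbT; case: ifP; case: (tgt e =P x) => // _ _ /eqP/negbTE->.
by move=> e /andP[/eqP tx /eqP sx]; have := fin_loopless e; rewrite tx sx eqxx.
Qed.

(** Let [x] be the first vertex, in the enumeration, at which [f] is maximal.  Along
    each edge entering [x] the function drops strictly towards the other end, which
    comes earlier, so [laplacian f x] is at least the indegree of [x] and the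
    coefficient of [E] at [x] would be at most -1. *)
Lemma orientation_divisor_noneffective (x0 : vertex G) E :
  (forall x, 0 <= coeff x E) -> ~ fin_lin_equiv orientation_divisor E.
Proof.
move=> effE [f Hf].
have [x1 _ max_x1] := arg_maxP f (erefl : xpredT x0).
have [x /eqP fx min_x] :=
  @arg_minnP _ x1 (fun x => f x == f x1) (fun x => enum_rank x) (eqxx _).
have max_x y : f y <= f x by rewrite fx; apply: max_x1.
have drop_f y e : x != y -> ((src e == x) && (tgt e == y))
    || ((src e == y) && (tgt e == x)) -> (upper_end e == x)%:Z <= f x - f y.
  move=> neq_xy He; case: (upper_end e =P x) => [up|_]; last first.
    by rewrite subr_ge0 max_x.
  have lt_yx : (enum_rank y < enum_rank x)%N.
    have neq : nat_of_ord (enum_rank x) != enum_rank y.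
      by rewrite (inj_eq val_inj) (inj_eq enum_rank_inj).
    move: up neq_xy; rewrite /upper_end.
    case/orP: He => /andP[/eqP-> /eqP->]; case: ifP => [lt|nlt] //.
    - by move->; rewrite eqxx.
    - by move=> _ _; rewrite ltn_neqAle eq_sym neq leqNgt nlt.
    - by move->; rewrite eqxx.
  have : f y != f x.
    apply/eqP => fyx; have := min_x y; rewrite fyx fx eqxx => /(_ isT).
    by rewrite leqNgt lt_yx.
  by have := max_x y; lia.
have := Hf x; have := effE x; rewrite coeff_orientation_divisor /laplacian.
have le_src : \sum_(e : edge G | src e == x) (upper_end e == x)%:Z
    <= \sum_(e : edge G | src e == x) (f x - f (tgt e)).
  apply: ler_sum => e /eqP ex; apply: drop_f; rewrite ?ex ?eqxx // -ex.
  exact: fin_loopless.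
have le_tgt : \sum_(e : edge G | tgt e == x) (upper_end e == x)%:Z
    <= \sum_(e : edge G | tgt e == x) (f x - f (src e)).
  apply: ler_sum => e /eqP ex; apply: drop_f; rewrite ?ex ?eqxx ?orbT // -ex.
  by rewrite eq_sym fin_loopless.
by move: le_src le_tgt; lia.
Qed.
End FiniteGraph.

(** * Piecewise linear functions on a segment *)

Section PiecewiseLinear.
Variable R : realType.
Implicit Types (h k : R -> R) (l x y : R).

(** The behaviour of a function on either side of a point is expressed by applying
    this, like [initial_slope], to its translate or reflected translate. *)
Definition germ h (s : int) : Prop :=
  exists2 eps : R, 0 < eps & forall u, 0 <= u < eps -> h u = h 0 + s%:~R * u.

Lemma germ_initial_slope h s : germ h s -> initial_slope h = s.
Proof.
case=> eps eps0 Hs; apply: xget_unique; first by exists eps.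
move=> r [del del0 Hr].
set u := Num.min eps del / 2.
have m0 : 0 < Num.min eps del by rewrite lt_min eps0 del0.
have u0 : 0 < u by rewrite divr_gt0.
have um : u < Num.min eps del by rewrite ltr_pdivrMr // mulr_natr mulr2n ltrDl.
have [ue ud] : u < eps /\ u < del by move: um; rewrite lt_min => /andP[].
have := Hr u; rewrite (Hs u) ?ue ?ud ?ltW // => /(_ isT)/addrI/mulIf.
by move=> /(_ (lt0r_neq0 u0))/intr_inj.
Qed.

Lemma germB h k s r : germ h s -> germ k r -> germ (fun u => h u - k u) (s - r).
Proof.
case=> eps eps0 Hs [del del0 Hr]; exists (Num.min eps del).
  by rewrite lt_min eps0.
move=> u /andP[u0]; rewrite lt_min => /andP[ue ud].
by rewrite (Hs u) ?(Hr u) ?u0 // rmorphB /= mulrBl opprD addrACA.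
Qed.

(** Linearity on both sides of every point, unlike a subdivision into pieces, is
    visibly inherited by differences. *)
Definition locally_linear l h : Prop :=
  (forall x, 0 <= x < l -> exists s, germ (fun u => h (x + u)) s) /\
  (forall x, 0 < x <= l -> exists s, germ (fun u => h (x - u)) s).

Lemma locally_linearB l h k : locally_linear l h -> locally_linear l k ->
  locally_linear l (fun x => h x - k x).
Proof.
move=> [hr hl] [kr kl]; split=> x lx.
  by have [[s hs] [r kr']] := (hr x lx, kr x lx); exists (s - r); apply: germB.
by have [[s hs] [r kr']] := (hl x lx, kl x lx); exists (s - r); apply: germB.
Qed.

Definition has_pieces l h (n : nat) (t : nat -> R) (s : nat -> int) : Prop :=
  [/\ t 0%N = 0, t n = l, (forall i, (i < n)%N -> t i < t i.+1)
    & forall i, (i < n)%N -> forall x, t i <= x <= t i.+1 ->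
        h x = h (t i) + (s i)%:~R * (x - t i)].

Lemma int_piecewise_linear_pieces l h :
  int_piecewise_linear l h -> exists n t s, has_pieces l h n t s.
Proof.
case=> n [t [t0 tn lt_t lin]]; exists n, t.
have /choice[s Hs] : forall i, exists s : int, (i < n)%N -> forall x,
    t i <= x <= t i.+1 -> h x = h (t i) + s%:~R * (x - t i).
  move=> i; case: (ltnP i n) => [/lin[s Hs]|_]; [by exists s|by exists 0].
by exists s.
Qed.

Lemma int_piecewise_linear_extend h x y s :
  int_piecewise_linear x h -> x < y ->
  (forall z, x <= z <= y -> h z = h x + s%:~R * (z - x)) ->
  int_piecewise_linear y h.
Proof.
case=> n [t [t0 tn lt_t lin]] xy Hxy.
exists n.+1, (fun i => if (i <= n)%N then t i else y); split => //.
- by rewrite ltnn.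
- move=> i; rewrite ltnS => le_i; rewrite le_i.
  case: ltnP => [/lt_t//|le_n]; rewrite (_ : i = n) ?tn //.
  by apply/eqP; rewrite eqn_leq le_i.
- move=> i; rewrite ltnS => le_i; rewrite le_i.
  case: ltnP => [/lin//|le_n]; rewrite (_ : i = n) ?tn; first by exists s.
  by apply/eqP; rewrite eqn_leq le_i.
Qed.

(** The supremum [c] of the points [x] such that [h] is piecewise linear on
    [[0, x]] is attained, by linearity to the left of [c], and linearity to the right
    of [c] excludes [c < l]. *)
Lemma int_piecewise_linear_of_germs l h :
  0 <= l -> locally_linear l h -> int_piecewise_linear l h.
Proof.
move=> l0 [hr hl].
pose S := [set x | 0 <= x <= l /\ int_piecewise_linear x h].
have S0 : S 0.
  split; first by rewrite lexx l0.
  by exists 0%N, (fun=> 0); split.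
have ubS : has_ubound S by exists l => x [/andP[]].
have supS : has_sup S by split => //; exists 0.
set c := sup S.
have c0 : 0 <= c by apply: ub_le_sup.
have cl : c <= l by apply: ge_sup; [exists 0|move=> x [/andP[]]].
have Sc : int_piecewise_linear c h.
  move: c0; rewrite le_eqVlt => /predU1P[<-|c0]; first by case: S0.
  have /hl[s [eps eps0 Hs]] : 0 < c <= l by rewrite c0.
  have [x [/andP[x0 xl] Sx] ltx] := sup_adherent eps0 supS.
  have : x <= c by apply: ub_le_sup => //; split => //; rewrite x0.
  rewrite le_eqVlt => /predU1P[<- //|xc].
  apply: (int_piecewise_linear_extend (s := - s) Sx xc) => z /andP[xz zc].
  have := Hs (c - z); have := Hs (c - x); rewrite !subKr subr0.
  move=> -> => [->|]; last first.
    by rewrite subr_ge0 (ltW xc) /= ltrBlDr -ltrBlDl.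
    by rewrite subr_ge0 zc /= ltrBlDr -ltrBlDl (lt_le_trans ltx).
  by rewrite rmorphN /=; ring.
have : c = l.
  apply/eqP; rewrite eq_le cl leNgt; apply/negP => lt_cl.
  have /hr[s [eps eps0 Hs]] : 0 <= c < l by rewrite c0.
  pose d := Num.min (eps / 2) (l - c).
  have d0 : 0 < d by rewrite lt_min divr_gt0 //= subr_gt0.
  have de : d < eps.
    by rewrite gt_min ltr_pdivrMr // mulr_natr mulr2n ltrDl eps0.
  have dl : c + d <= l by rewrite -lerBrDl ge_min lexx orbT.
  have : S (c + d).
    split; first by rewrite dl addr_ge0 // ltW.
    apply: (int_piecewise_linear_extend (s := s) Sc); first by rewrite ltrDl.
    move=> z /andP[cz zd]; have := Hs (z - c); rewrite addr0 subrKC => -> //.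
    by rewrite subr_ge0 cz /=; apply: le_lt_trans de; rewrite lerBlDl.
  by move=> /(ub_le_sup ubS); rewrite -/c gerDl leNgt d0.
by move=> <-.
Qed.

Section Pieces.
Variables (l : R) (h : R -> R) (n : nat) (t : nat -> R) (s : nat -> int).
Hypothesis pcs : has_pieces l h n t s.

Let t0 : t 0%N = 0. Proof. by case: pcs. Qed.
Let tn : t n = l. Proof. by case: pcs. Qed.

Lemma knot_lt (i j : nat) : (i < j <= n)%N -> t i < t j.
Proof.
case: pcs => _ _ lt_t _; elim: j => // j IHj.
rewrite ltnS => /andP[]; rewrite leq_eqVlt => /predU1P[->|lt_ij] lt_j.
  exact: lt_t.
by apply: lt_trans (lt_t _ lt_j); apply: IHj; rewrite lt_ij ltnW.
Qed.

Lemma knot_le (i j : nat) : (i <= j <= n)%N -> t i <= t j.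
Proof.
move=> /andP[]; rewrite leq_eqVlt => /predU1P[->//|ij jn].
by apply/ltW/knot_lt/andP.
Qed.

Lemma piece_right_germ i x : (i < n)%N -> t i <= x < t i.+1 ->
  germ (fun u => h (x + u)) (s i).
Proof.
case: pcs => _ _ _ lin lt_i /andP[ix xi]; exists (t i.+1 - x).
  by rewrite subr_gt0.
move=> u /andP[u0 ux].
rewrite addr0 (lin i lt_i (x + u)) 1?(lin i lt_i x) ?ix ?(ltW xi) //; first by ring.
by rewrite (le_trans ix) ?lerDl //= -lerBrDl ltW.
Qed.

Lemma piece_left_germ i x : (i < n)%N -> t i < x <= t i.+1 ->
  germ (fun u => h (x - u)) (- s i).
Proof.
case: pcs => _ _ _ lin lt_i /andP[ix xi]; exists (x - t i).
  by rewrite subr_gt0.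
move=> u /andP[u0 ux].
rewrite subr0 (lin i lt_i (x - u)) 1?(lin i lt_i x) ?xi ?(ltW ix) //.
  by rewrite rmorphN /=; ring.
by rewrite lerBrDr -lerBrDl ltW //= lerBlDr (le_trans xi) // lerDl.
Qed.

Lemma piece_right x : 0 <= x < l -> exists2 i, (i < n)%N & t i <= x < t i.+1.
Proof.
move=> /andP[x0 xl].
have ex_gt : exists i, x < t i by exists n; rewrite tn.
case: (ex_minnP ex_gt) => -[|i] lt_x min_i; first by rewrite t0 ltNge x0 in lt_x.
exists i; first by apply: min_i; rewrite tn.
by rewrite lt_x andbT leNgt; apply/negP => /min_i; rewrite ltnn.
Qed.

Lemma piece_left x : 0 < x <= l -> exists2 i, (i < n)%N & t i < x <= t i.+1.
Proof.
move=> /andP[x0 xl].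
have ex_ge : exists i, x <= t i by exists n; rewrite tn.
case: (ex_minnP ex_ge) => -[|i] le_x min_i; first by rewrite t0 leNgt x0 in le_x.
exists i; first by apply: min_i; rewrite tn.
by rewrite le_x andbT ltNge; apply/negP => /min_i; rewrite ltnn.
Qed.

Lemma pieces_locally_linear : locally_linear l h.
Proof.
split=> x lx.
  by have [i lt_i ix] := piece_right lx; exists (s i); apply: piece_right_germ ix.
by have [i lt_i ix] := piece_left lx; exists (- s i); apply: piece_left_germ ix.
Qed.

Definition right_slope (f : R -> R) x : int := initial_slope (fun u => f (x + u)).
Definition left_slope (f : R -> R) x : int := initial_slope (fun u => f (x - u)).

Lemma right_slope_pieces x : 0 <= x < l ->
  right_slope h x = \sum_(i < n) s i * (t i <= x < t i.+1)%R%:Z.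
Proof.
move=> lx; have [i lt_i ix] := piece_right lx.
rewrite /right_slope (germ_initial_slope (piece_right_germ lt_i ix)).
rewrite (bigD1 (Ordinal lt_i)) //= ix mulr1 big1 ?addr0 // => j neq_ji.
case: (boolP (_ <= _ < _)) => [|_]; rewrite ?mulr0 // => /andP[jx xj].
have /andP[ix1 ix2] := ix; have := neq_ji; rewrite -(inj_eq val_inj) /=.
case: ltngtP => // [lt_ji|lt_ij] _.
  have := @knot_le j.+1 i; rewrite lt_ji ltnW // => /(_ isT)/(lt_le_trans xj).
  by rewrite ltNge ix1.
have := @knot_le i.+1 j; rewrite lt_ij ltnW // => /(_ isT)/(lt_le_trans ix2).
by rewrite ltNge jx.
Qed.

Lemma left_slope_pieces x : 0 < x <= l ->
  left_slope h x = - \sum_(i < n) s i * (t i < x <= t i.+1)%R%:Z.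
Proof.
move=> lx; have [i lt_i ix] := piece_left lx.
rewrite /left_slope (germ_initial_slope (piece_left_germ lt_i ix)); congr (- _).
rewrite (bigD1 (Ordinal lt_i)) //= ix mulr1 big1 ?addr0 // => j neq_ji.
case: (boolP (_ < _ <= _)) => [|_]; rewrite ?mulr0 // => /andP[jx xj].
have /andP[ix1 ix2] := ix; have := neq_ji; rewrite -(inj_eq val_inj) /=.
case: ltngtP => // [lt_ji|lt_ij] _.
  have := @knot_le j.+1 i; rewrite lt_ji ltnW // => /(_ isT)/(le_trans xj).
  by rewrite leNgt ix1.
have := @knot_le i.+1 j; rewrite lt_ij ltnW // => /(_ isT)/(le_trans ix2).
by rewrite leNgt jx.
Qed.

(** The coefficient at [x] of the boundary, up to sign, of the 1-chain that gives the
    piece [[t i, t i.+1]] the weight [s i]. *)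
Definition kink_sum x : int :=
  \sum_(i < n) s i * ((t i == x)%:Z - (t i.+1 == x)%:Z).

(** Termwise: a half-open interval closed on the left and the one closed on the right
    differ by their end points. *)
Lemma kink_sumE x : kink_sum x =
  \sum_(i < n) s i * (t i <= x < t i.+1)%R%:Z
  - \sum_(i < n) s i * (t i < x <= t i.+1)%R%:Z.
Proof.
rewrite -sumrB; apply: eq_bigr => i _; rewrite -mulrBr; congr (_ * _).
have lt_t : t i < t i.+1 by apply: knot_lt; rewrite ltnSn ltn_ord.
by case: (ltrgtP (t i) x) => ix; case: (ltrgtP (t i.+1) x) => xi //; exfalso; lra.
Qed.

Lemma kink_sum_inner x : 0 < x < l ->
  kink_sum x = right_slope h x + left_slope h x.
Proof.
move=> /andP[x0 xl]; rewrite kink_sumE right_slope_pieces ?left_slope_pieces //.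
  by rewrite x0 ltW.
by rewrite xl ltW.
Qed.

Lemma kink_sum_left : 0 < l -> kink_sum 0 = right_slope h 0.
Proof.
move=> l0; rewrite kink_sumE right_slope_pieces ?lexx //.
rewrite [X in _ - X]big1 ?subr0 // => i _.
have t_ge0 : 0 <= t i by rewrite -t0 knot_le // leq0n ltnW.
by rewrite ltNge t_ge0 mulr0.
Qed.

Lemma kink_sum_right : 0 < l -> kink_sum l = left_slope h l.
Proof.
move=> l0; rewrite kink_sumE left_slope_pieces ?l0 ?lexx //.
rewrite [X in X - _]big1 ?sub0r // => i _.
have t_le : t i.+1 <= l by rewrite -tn knot_le // ltn_ord leqnn.
by rewrite [l < _]ltNge t_le andbF mulr0.
Qed.

Lemma pieces_gt0 : 0 < l -> (0 < n)%N.
Proof. by rewrite -tn; case: n => //; rewrite t0 ltxx. Qed.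

Lemma right_slope_knot i : (i < n)%N -> right_slope h (t i) = s i.
Proof.
move=> lt_i; apply/germ_initial_slope/(piece_right_germ lt_i).
by rewrite lexx knot_lt // ltnSn.
Qed.

Lemma left_slope_knot i : (i < n)%N -> left_slope h (t i.+1) = - s i.
Proof.
move=> lt_i; apply/germ_initial_slope/(piece_left_germ lt_i).
by rewrite lexx knot_lt // ltnSn.
Qed.

Lemma pieces_increment : h l - h 0 = \sum_(i < n) (s i)%:~R * (t i.+1 - t i).
Proof.
case: pcs => _ _ lt_t lin; rewrite -{1}tn -{1}t0 -(telescope_sumr (h \o t)) //.
rewrite big_mkord; apply: eq_bigr => i _ /=.
by rewrite (lin i _ (t i.+1)) ?lexx ?andbT ?(ltW (lt_t _ _)) // addrC addKr.
Qed.

(** A function with integer slopes whose slope never increases, except possibly by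
    one at a single point [m], has all slopes nonpositive once it starts
    downwards, and all slopes nonnegative once it arrives upwards. *)
Section Kinks.
Variable m : R.
Hypothesis l_gt0 : 0 < l.
Hypothesis kinks : forall x, 0 < x < l ->
  right_slope h x + left_slope h x <= (x == m)%:Z.

Lemma piece_slope_le i j : (i <= j < n)%N ->
  s j <= s i + (t i < m <= t j)%R%:Z.
Proof.
elim: j => [|j IHj] /andP[le_ij lt_j].
  by move: le_ij; rewrite leqn0 => /eqP->; rewrite lerDl.
move: le_ij; rewrite leq_eqVlt => /predU1P[->|lt_ij]; first by rewrite lerDl.
have inner : 0 < t j.+1 < l.
  by rewrite -t0 -tn !knot_lt // ?lt_j ?leqnn //= ltnW.
have lt_t : t j < t j.+1 by rewrite knot_lt // ltnSn ltnW.
have le_t : t i <= t j by rewrite knot_le // -ltnS lt_ij ltnW // ltnW.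
have jump : s j.+1 <= s j + (t j.+1 == m)%:Z.
  have := kinks inner; rewrite right_slope_knot // left_slope_knot 1?ltnW //.
  by rewrite lerBlDl.
have IH : s j <= s i + (t i < m <= t j)%R%:Z by apply: IHj; rewrite -ltnS lt_ij ltnW.
apply: le_trans jump _; apply: le_trans (lerD IH (lexx _)) _.
rewrite -addrA lerD2l; case: (t j.+1 =P m) => [<-|_].
  by rewrite lexx [t j.+1 <= t j]leNgt lt_t andbF (le_lt_trans le_t).
rewrite addr0; case: (boolP (t i < m <= t j)) => // /andP[-> /le_trans->] //.
exact: ltW.
Qed.

Lemma right_slope_lt0_decr : right_slope h 0 < 0 -> h l < h 0.
Proof.
have n0 := pieces_gt0 l_gt0; rewrite -{1}t0 right_slope_knot // => s0.
have s_le i : (i < n)%N -> s i <= 0.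
  by move=> lt_i; have := @piece_slope_le 0 i; rewrite lt_i => /(_ isT); lia.
rewrite -subr_lt0 pieces_increment (bigD1 (Ordinal n0)) //=.
apply: ltr_wnDr.
  apply: sumr_le0 => i _; apply: mulr_le0_ge0; first by rewrite lerz0 s_le.
  by rewrite subr_ge0 knot_le // leqnSn ltn_ord.
by rewrite nmulr_rlt0 ?ltrz0 // subr_gt0 knot_lt.
Qed.

Lemma left_slope_lt0_incr : left_slope h l < 0 -> h 0 < h l.
Proof.
have n0 := pieces_gt0 l_gt0; have lt_n : (n.-1 < n)%N by rewrite prednK.
rewrite -{1}tn -(prednK n0) left_slope_knot // => sn.
have s_ge i : (i < n)%N -> 0 <= s i.
  move=> lt_i; have := @piece_slope_le i n.-1; rewrite lt_n -ltnS prednK // lt_i.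
  by move=> /(_ isT); lia.
rewrite -subr_gt0 pieces_increment (bigD1 (Ordinal lt_n)) //=.
apply: ltr_wpDr.
  apply: sumr_ge0 => i _; apply: mulr_ge0; first by rewrite ler0z s_ge.
  by rewrite subr_ge0 knot_le // leqnSn ltn_ord.
apply: mulr_gt0; first by rewrite ltr0z -oppr_lt0.
by rewrite subr_gt0 knot_lt // prednK // leqnn.
Qed.

End Kinks.

End Pieces.
End PiecewiseLinear.

(** * Metric graphs *)

Section MetricGraph.
Variables (R : realType) (G : metric_graph R).
Implicit Types (e : edge G) (x : vertex G) (p : metric_point G)
  (f g : metric_point G -> R) (D E C : {freeg (metric_point G)}).

Lemma chart_src e : chart e 0 = inl (src e).
Proof. by rewrite /chart; case: insubP => [u|_]; rewrite ?ltxx ?lexx. Qed.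

Lemma chart_tgt e : chart e (len e) = inl (tgt e).
Proof.
by rewrite /chart; case: insubP => [u|_]; rewrite ?ltxx ?andbF // leNgt len_gt0.
Qed.

Lemma chart_eq_inner e (t : R) e' (u : {t : R | 0 < t < len e'}) :
  (chart e t == inr (Tagged (fun e => {t : R | 0 < t < len e}) u) :> metric_point G)
    = (e == e') && (t == val u).
Proof.
rewrite /chart; case: insubP => [v _ vt|].
  rewrite -vt; case: (e =P e') => [ee'|neq]; last first.
    by apply/negbTE/eqP => -[/neq].
  by case: _ / ee' u => u; rewrite (inj_eq inr_inj) eq_Tagged.
by move=> tl; apply/esym/negbTE; apply: contra tl => /andP[/eqP-> /eqP->]; case: u.
Qed.

Lemma chart_eq_vertex e (t : R) x : 0 <= t <= len e ->
  (chart e t == inl x)%:Z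
    = (t == 0)%:Z * (src e == x)%:Z + (t == len e)%:Z * (tgt e == x)%:Z.
Proof.
move=> /andP[t0 tl]; have l0 := len_gt0 e.
have [->|nt0] := eqVneq t 0.
  by rewrite chart_src lt_eqF //= (inj_eq inl_inj) mul1r mul0r addr0.
have [->|ntl] := eqVneq t (len e).
  by rewrite chart_tgt (inj_eq inl_inj) mul1r mul0r add0r.
by rewrite /chart; case: insubP => [v|] //; rewrite !lt_neqAle t0 tl ntl eq_sym nt0.
Qed.

Lemma ord_at_vertex f x : ord_at f (inl x) =
  \sum_(e : edge G | src e == x) right_slope (fun t => f (chart e t)) 0
  + \sum_(e : edge G | tgt e == x) left_slope (fun t => f (chart e t)) (len e).
Proof.
rewrite /= /right_slope; congr (_ + _); apply: eq_bigr => e _.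
by congr initial_slope; apply: funext => u; rewrite add0r.
Qed.

Lemma rational_functionE f :
  rational_function f <-> forall e, locally_linear (len e) (fun t => f (chart e t)).
Proof.
split=> Hf e; last exact/int_piecewise_linear_of_germs/Hf/ltW/len_gt0.
by have [n [t [s]]] := int_piecewise_linear_pieces (Hf e);
  apply: pieces_locally_linear.
Qed.

Lemma rational_functionB f g : rational_function f -> rational_function g ->
  rational_function (fun p => f p - g p).
Proof.
rewrite !rational_functionE => rf rg e.
exact: locally_linearB (rf e) (rg e).
Qed.

Lemma right_slopeB (l x : R) (h k : R -> R) :
  locally_linear l h -> locally_linear l k -> 0 <= x < l ->
  right_slope (fun t => h t - k t) x = right_slope h x - right_slope k x.
Proof.
move=> [hr _] [kr _] lx; have [[s hs] [r kr']] := (hr x lx, kr x lx).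
rewrite /right_slope (germ_initial_slope hs) (germ_initial_slope kr').
exact/germ_initial_slope/germB.
Qed.

Lemma left_slopeB (l x : R) (h k : R -> R) :
  locally_linear l h -> locally_linear l k -> 0 < x <= l ->
  left_slope (fun t => h t - k t) x = left_slope h x - left_slope k x.
Proof.
move=> [_ hl] [_ kl] lx; have [[s hs] [r kr]] := (hl x lx, kl x lx).
rewrite /left_slope (germ_initial_slope hs) (germ_initial_slope kr).
exact/germ_initial_slope/germB.
Qed.

Lemma ord_atB f g p : rational_function f -> rational_function g ->
  ord_at (fun p => f p - g p) p = ord_at f p - ord_at g p.
Proof.
rewrite !rational_functionE => rf rg; case: p => [x|[e u]].
  rewrite !ord_at_vertex opprD addrACA -!sumrB.
  congr (_ + _); apply: eq_bigr => e _.
    by rewrite (right_slopeB (rf e) (rg e)) // lexx len_gt0.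
  by rewrite (left_slopeB (rf e) (rg e)) // lexx len_gt0.
have /andP[u0 ul] := valP u.
rewrite /= -/(right_slope (fun t => f (chart e t) - g (chart e t)) (val u)).
rewrite -/(left_slope (fun t => f (chart e t) - g (chart e t)) (val u)).
rewrite (right_slopeB (rf e) (rg e)) ?(left_slopeB (rf e) (rg e)) ?u0 ?ul ?ltW //.
by rewrite opprD addrACA.
Qed.

Lemma met_lin_equivB D D' C C' : met_lin_equiv D D' -> met_lin_equiv C C' ->
  met_lin_equiv (D - C) (D' - C').
Proof.
move=> [f rf Hf] [g rg Hg]; exists (fun p => f p - g p).
  exact: rational_functionB.
by move=> p; rewrite ord_atB // -Hf -Hg !coeffB; ring.
Qed.

(** The divisor of a rational function is the boundary of its 1-chain of slopes:
    within an edge the pieces on both sides of [p] contribute, and at a vertex the first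
    and last pieces of the edges. *)
Lemma ord_at_pieces f (n : edge G -> nat) (t : edge G -> nat -> R)
    (s : edge G -> nat -> int) p :
  (forall e, has_pieces (len e) (fun t => f (chart e t)) (n e) (t e) (s e)) ->
  ord_at f p = \sum_(e : edge G) \sum_(i < n e)
    s e i * ((chart e (t e i) == p)%:Z - (chart e (t e i.+1) == p)%:Z).
Proof.
move=> pcs; case: p => [x|[e u]].
  have knot_in e i : (i <= n e)%N -> 0 <= t e i <= len e.
    move=> le_i; have [t0 tn _ _] := pcs e.
    by rewrite -{1}t0 -tn !(knot_le (pcs e)) ?le_i ?leqnn.
  rewrite ord_at_vertex [X in X + _]big_mkcond [X in _ + X = _]big_mkcond.
  rewrite -big_split /=; apply: eq_bigr => e _.
  rewrite -(kink_sum_left (pcs e)) ?len_gt0 // -(kink_sum_right (pcs e)) ?len_gt0 //.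
  rewrite (eq_bigr (fun i : 'I_(n e) =>
      (src e == x)%:Z * (s e i * ((t e i == 0)%:Z - (t e i.+1 == 0)%:Z))
      + (tgt e == x)%:Z * (s e i * ((t e i == len e)%:Z - (t e i.+1 == len e)%:Z)))).
    rewrite big_split /= -!mulr_sumr -!/(kink_sum _ _ _ _).
    by congr (_ + _); case: eqP; rewrite ?mul1r ?mul0r.
  move=> i _; rewrite !chart_eq_vertex ?knot_in // 1?ltnW //.
  by ring.
have -> : ord_at f (inr (existT _ e u)) = kink_sum (n e) (t e) (s e) (val u).
  by rewrite (kink_sum_inner (pcs e)) // (valP u).
rewrite (bigD1 e) //= [X in _ + X]big1 ?addr0.
  by apply: eq_bigr => i _; rewrite !chart_eq_inner eqxx.
move=> e' /negbTE neq; rewrite big1 // => i _.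
by rewrite !chart_eq_inner neq subrr mulr0.
Qed.

Lemma met_lin_equiv_deg D C : met_lin_equiv D C -> deg D = deg C.
Proof.
move=> [f rf Hf]; apply/eqP; rewrite -subr_eq0 -degB.
have /choice[pc Hpc] : forall e, exists c : nat * (nat -> R) * (nat -> int),
    has_pieces (len e) (fun t => f (chart e t)) c.1.1 c.1.2 c.2.
  move=> e; have [n [t [s Hs]]] := int_piecewise_linear_pieces (rf e).
  by exists (n, t, s).
pose knot e i := chart e ((pc e).1.2 i).
have -> : D - C = \sum_(e : edge G) \sum_(i < (pc e).1.1)
    (<< (pc e).2 i *g knot e i >> - << (pc e).2 i *g knot e i.+1 >>).
  apply/eqP/freeg_eqP => p; rewrite coeffB Hf (ord_at_pieces p Hpc) raddf_sum.
  apply: eq_bigr => e _; rewrite raddf_sum; apply: eq_bigr => i _ /=.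
  by rewrite coeffB !coeffU !natz mulrBr.
rewrite raddf_sum big1 // => e _; rewrite raddf_sum big1 // => i _ /=.
by rewrite degB !degU subrr.
Qed.

Lemma midpoint_subproof e : 0 < len e / 2 < len e.
Proof.
by rewrite divr_gt0 ?len_gt0 //= ltr_pdivrMr // mulr_natr mulr2n ltrDl len_gt0.
Qed.

Definition midpoint e : metric_point G :=
  inr (Tagged (fun e => {t : R | 0 < t < len e})
    (exist (fun t : R => 0 < t < len e) _ (midpoint_subproof e))).

(** The divisor of the orientation of the subdivided graph in which every half edge
    points to the midpoint (indegree minus one).  Passing to midpoints makes the
    orientation acyclic even in the presence of loops. *)
Definition midpoint_divisor : {freeg (metric_point G)} :=
  \sum_(e : edge G) << midpoint e >>
  - \sum_(x : vertex G) << (inl x : metric_point G) >>.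

Lemma deg_midpoint_divisor :
  deg midpoint_divisor = #|edge G|%:Z - #|vertex G|%:Z.
Proof.
rewrite degB; congr (_ - _); rewrite raddf_sum.
all: by rewrite (eq_bigr (fun=> 1)) ?sumr_const ?natz // => *; rewrite /= degU.
Qed.

Lemma coeff_midpoint_divisor_vertex x : coeff (inl x) midpoint_divisor = -1.
Proof.
rewrite coeffB raddf_sum big1 ?sub0r; last by move=> e _; rewrite /= coeffU mulr0.
congr (- _); rewrite raddf_sum (bigD1 x) //= coeffU eqxx big1 // => y /negbTE neq.
by rewrite coeffU (inj_eq inl_inj) neq mulr0.
Qed.

Lemma coeff_midpoint_divisor_inner e (u : {t : R | 0 < t < len e}) :
  coeff (inr (Tagged (fun e => {t : R | 0 < t < len e}) u)) midpoint_divisor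
    = (val u == len e / 2)%:Z.
Proof.
rewrite coeffB [X in _ - X]raddf_sum [X in _ - X]big1 ?subr0; last first.
  by move=> x _; rewrite /= coeffU mulr0.
rewrite raddf_sum /= (bigD1 e) //= big1 ?addr0; last first.
  move=> e' /eqP neq; rewrite coeffU (_ : _ == _ = false) ?mulr0 //.
  by apply/negbTE/eqP => -[/neq].
by rewrite coeffU (inj_eq inr_inj) eq_Tagged /= -val_eqE /= mul1r natz eq_sym.
Qed.

(** If [f] carried the equivalence, its slope along an edge could not increase, save
    by at most one at the midpoint. At a vertex [x] where [f] is smallest among
    vertices, an edge on which [f] leaves [x] downwards would have nonpositive
    slope throughout and end at a smaller value; so all outgoing slopes at [x]
    are nonnegative, while the coefficient -1 of the divisor at [x] makes their
    sum negative. *)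
Lemma midpoint_divisor_noneffective (x0 : vertex G) E :
  (forall p, 0 <= coeff p E) -> ~ met_lin_equiv midpoint_divisor E.
Proof.
move=> effE [f rf Hf].
have [x _ min_x] := @Order.TotalTheory.arg_minP _ _ _ x0 xpredT (fun x => f (inl x)) isT.
have kinks e t : 0 < t < len e -> right_slope (fun t => f (chart e t)) t
    + left_slope (fun t => f (chart e t)) t <= (t == len e / 2)%:Z.
  move=> t_in; set q := inr (Tagged (fun e => {t : R | 0 < t < len e})
    (exist (fun t : R => 0 < t < len e) t t_in)) : metric_point G.
  rewrite -(coeff_midpoint_divisor_inner (exist (fun t : R => 0 < t < len e) t t_in)) -/q.
  by rewrite -[leLHS]/(ord_at f q) -Hf gerBl effE.
have := Hf (inl x); rewrite coeff_midpoint_divisor_vertex ord_at_vertex => eq_x.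
have : 0 <= ord_at f (inl x).
  rewrite ord_at_vertex; apply: addr_ge0; apply: sumr_ge0 => e /eqP ex.
    have [n [t [s pcs]]] := int_piecewise_linear_pieces (rf e).
    rewrite leNgt; apply/negP => /(right_slope_lt0_decr pcs (len_gt0 e) (@kinks e)).
    by rewrite chart_src chart_tgt ex ltNge min_x.
  have [n [t [s pcs]]] := int_piecewise_linear_pieces (rf e).
  rewrite leNgt; apply/negP => /(left_slope_lt0_incr pcs (len_gt0 e) (@kinks e)).
  by rewrite chart_src chart_tgt ex ltNge min_x.
by rewrite ord_at_vertex -eq_x; have := effE (inl x); lia.
Qed.

End MetricGraph.

(** * Ranks and Riemann's bound *)

Section Ranks.
Variables (R : realType) (G : graph R).
Implicit Types (D E C : divisor G) (v w p : point G).

Lemma deg_effective D : effective D -> 0 <= deg D.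
Proof.
move=> effD; rewrite -(freeg_sumE D) raddf_sum sumr_ge0 // => p _.
by rewrite /= degU effD.
Qed.

Lemma effectiveD D E : effective D -> effective E -> effective (D + E).
Proof. by move=> effD effE p; rewrite coeffD addr_ge0. Qed.

Lemma effectiveU (k : int) p : 0 <= k -> effective (<< k *g p >> : divisor G).
Proof. by move=> k0 q; rewrite coeffU mulr_ge0. Qed.

Lemma lin_equiv_eq_diff D D' C C' :
  D - D' = C - C' -> lin_equiv D D' -> lin_equiv C C'.
Proof.
rewrite /lin_equiv; case: G D D' C C' => H D D' C C' eqDC.
  by case=> f Hf; exists f => x; rewrite -coeffB -eqDC coeffB.
by case=> f rf Hf; exists f => // x; rewrite -coeffB -eqDC coeffB.
Qed.

(** When [D] is equivalent to an effective divisor, the set that defines its rank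
    contains [0], the default value of [zmax]; hence the rank belongs to it,
    whether or not the maximum exists. A smaller [E] is completed to degree
    [rank D] by a multiple of any point. *)
Lemma equiv_effective_sub D E : effective E -> deg E <= rank D ->
  equiv_effective (D - E).
Proof.
move=> effE; have degE := deg_effective effE.
rewrite /rank; case: asboolP => [eqD|_ /(le_trans degE)//].
set S := [set r : int | _]; rewrite /zmax.
have S0 : S 0.
  split=> // C effC /fgpos_eq0P -> //; first by rewrite subr0.
  by apply/fgposP.
have : S (zmax S) by rewrite /zmax; case: xgetP => // m _ [].
rewrite /zmax; set r := xget _ _ => -[r0 Sr] le_r.
have [[p _]|noP] := pselect (exists p : point G, True); last first.
  suff -> : E = 0 by rewrite subr0.
  by apply/eqP/freeg_eqP => p; case: noP; exists p.
have k0 : 0 <= r - deg E by rewrite subr_ge0.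
pose C : divisor G := << (r - deg E) *g p >>.
have [|| E' effE' eqE'] := Sr (E + C).
- by apply: effectiveD effE _; apply: effectiveU.
- by rewrite degD degU addrC subrK.
exists (E' + C); first by apply: effectiveD effE' _; apply: effectiveU.
by apply: lin_equiv_eq_diff eqE'; rewrite !opprD !addrA [LHS]addrAC.
Qed.

Lemma rank_ge0 D : 0 <= rank D -> equiv_effective D.
Proof. by rewrite /rank; case: asboolP. Qed.

Lemma lin_equiv_deg D E : lin_equiv D E -> deg D = deg E.
Proof.
rewrite /lin_equiv; case: G D E => H D E; first exact: fin_lin_equiv_deg.
exact: met_lin_equiv_deg.
Qed.

Lemma lin_equivB D D' C C' :
  lin_equiv D D' -> lin_equiv C C' -> lin_equiv (D - C) (D' - C').
Proof.
rewrite /lin_equiv; case: G D D' C C' => H D D' C C'; first exact: fin_lin_equivB.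
exact: met_lin_equivB.
Qed.

Lemma exists_noneffective p : exists2 nu : divisor G,
  ~ equiv_effective nu & (genus G)%:Z - 1 <= deg nu.
Proof.
rewrite /equiv_effective /effective /lin_equiv /genus; case: G p => H p.
  exists (orientation_divisor H).
    by case=> E effE; apply: (orientation_divisor_noneffective p effE).
  rewrite deg_orientation_divisor.
  by have := betti1_le p (@fin_connected H); lia.
have x0 : vertex H by case: p => [x|[e _]]; [exact: x | exact: src e].
exists (midpoint_divisor H).
  by case=> E effE; apply: (midpoint_divisor_noneffective x0 effE).
rewrite deg_midpoint_divisor.
by have := betti1_le x0 (@met_connected _ H); lia.
Qed.

(** If [E] is effective and equivalent to [D - nu], and [D - E] is equivalent to an
    effective divisor, then so is [nu], as [nu] differs from [D - E] by
    [D - nu - E]. *)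
Lemma rank_lt_deg_sub D nu : ~ equiv_effective nu ->
  0 <= rank (D - nu) -> rank D < deg D - deg nu.
Proof.
move=> non_nu /rank_ge0[E effE eqE].
rewrite -degB (lin_equiv_deg eqE) ltNge; apply/negP => le_E.
have [C effC eqC] := equiv_effective_sub effE le_E.
apply: non_nu; exists C => //.
apply: lin_equiv_eq_diff (lin_equivB eqC eqE).
by apply/eqP/freeg_eqP => p /=; rewrite !coeffB; ring.
Qed.

Lemma twist_v v w D (a : int) : twist v w D a 0 = D + << a *g v >>.
Proof. by rewrite /twist freegU0 subr0. Qed.

(** Here the permutation of [D - nu] replaces the lower bound of Riemann's theorem: it
    shows that [D - nu + a v] has nonnegative rank as soon as [tau 0 <= a]. *)
Lemma eventually_rank_le v w D : zero_general_transmission v w ->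
  exists a0 : int, forall a : int, a0 <= a ->
    rank (D + << a *g v >>) <= deg D + a - (genus G)%:Z.
Proof.
move=> gen; have [nu non_nu deg_nu] := exists_noneffective v.
have [_ [tau [[_ rk _] _ _]]] := gen (D - nu).
exists (tau 0) => a le_a.
have : rank (D + << a *g v >>) < deg (D + << a *g v >>) - deg nu.
  apply: rank_lt_deg_sub => //.
  have [s [_ mem_s eq_s]] := has_card_seq (rk a 0).
  rewrite addrAC -(twist_v v w).
  have : 0 \in s by apply/mem_s.
  by case: s {mem_s} eq_s => //= n s eq_s _; rewrite -(lerD2r 1) eq_s.
by rewrite degD degU; move: (rank _) (deg D) (deg nu) deg_nu; lia.
Qed.

(** The points at which [tau] takes the values 1, ..., a, together with those of
    [A], lie in [B] or are counted by the rank of [D + a v]; [a] is taken large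
    enough for Riemann's upper bound. *)
Lemma riemann_bound v w D (A B : seq int) (tau : int -> int) :
  zero_general_transmission v w -> transmission_permutation v w D tau ->
  uniq A ->
  (forall n : int, n \in A <-> 0 <= n /\ tau n <= 0) ->
  (forall n : int, n \in B <-> n < 0 /\ 0 < tau n) ->
  (size A)%:Z + (genus G)%:Z <= deg D + 1 + (size B)%:Z.
Proof.
move=> gen [[tinv tauK tinvK] rk _] uA memA memB.
have [a0 le_rk] := eventually_rank_le D gen.
pose a := absz a0.
have [C [uC memC sizeC]] := has_card_seq (rk a%:Z 0).
pose P := [seq tinv k%:Z | k <- iota 1 a].
have uAP : uniq (A ++ P).
  rewrite cat_uniq uA map_inj_uniq ?iota_uniq ?andbT /=.
    apply/hasPn => _ /mapP[k + ->]; rewrite mem_iota => k1.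
    by apply/negP => /memA[_]; rewrite tinvK; lia.
  by move=> k l /(can_inj tinvK)[].
have sub : {subset A ++ P <= C ++ B}.
  move=> n; rewrite !mem_cat => /orP[/memA[n0 tn]|/mapP[k + ->]].
    by apply/orP; left; apply/memC; split=> //; apply: le_trans tn _.
  rewrite mem_iota => k1; case: (lerP 0 (tinv k%:Z)) => tk; apply/orP.
    by left; apply/memC; rewrite /= tinvK; split => //; lia.
  by right; apply/memB; rewrite tinvK; split => //; lia.
have le_size : (size A + a <= size C + size B)%N.
  by have := uniq_leq_size uAP sub; rewrite !size_cat size_map size_iota.
have le_a : a0 <= a%:Z by lia.
by move: sizeC (le_rk _ le_a); rewrite twist_v; move: (rank _) (deg D); lia.
Qed.

Lemma sum_vanishing_le (D : divisor G) u (A : seq int) (key : int -> nat) :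
  uniq [seq key n | n <- A] ->
  (forall a : int, 0 <= a -> rank (D - << a *g u >>) + 1
     = count (fun n => a <= (key n)%:Z) A) ->
  \sum_(0 <= i < size A) (vanishing D u i - i%:Z)
    <= (\sum_(n <- A) gap [seq key m | m <- A] (key n))%N.
Proof.
move=> uK rk; have := @sum_zmax_count_le _ (fun a => rank (D - << a *g u >>)) uK.
rewrite size_map big_map /= freegU0 subr0; apply=> a /rk->.
by rewrite count_map.
Qed.

End Ranks.

Theorem theoremB (R : realType) (G : graph R) (v w : point G) :
  zero_general_transmission v w ->
  forall (D : divisor G) (d r : int),
    d = deg D -> r = rank D ->
    let g := (genus G)%:Z in
    let a := vanishing D v in
    let b := vanishing D w in
    0 <= g - (r + 1) * (g - d + r)
         - \sum_(0 <= i < absz (r + 1)) (a i - i%:Z)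
         - \sum_(0 <= i < absz (r + 1)) (b i - i%:Z).
Proof.
move=> gen D d r -> -> /=.
have [_ [tau [trans finI inv_le]]] := gen D.
have [tau_bij rk rkK] := trans.
have twist00 : twist v w D 0 0 = D by rewrite twist_v freegU0 addr0.
have [A [uA /= memA sizeA]] := has_card_seq (rk 0 0).
have [B [uB /= memB sizeB]] := has_card_seq (rkK 0 0).
rewrite twist00 in sizeA.
have bound := riemann_bound gen trans uA memA memB.
have gaps := gaps_le_inv0 tau_bij finI uA uB memA memB.
have sum_a : \sum_(0 <= i < size A) (vanishing D v i - i%:Z)
    <= (\sum_(n <- A) gap [seq absz (tau m) | m <- A] (absz (tau n)))%N.
  apply: (@sum_vanishing_le _ _ D v A (fun n => absz (tau n))) => [|a a0].
    rewrite map_inj_in_uniq // => m n /memA[_ tm] /memA[_ tn] eq_mn.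
    by apply: (bij_inj tau_bij); lia.
  rewrite -size_filter; apply: (@has_card_size [set n | 0 <= n /\ tau n <= - a]).
  - by have := rk (- a) 0; rewrite twist_v freegUN.
  - exact: filter_uniq.
  - move=> n; rewrite mem_filter /=; split => [/andP[le_a /memA[n0 tn]]|[n0 tn]].
      by split=> //; lia.
    by apply/andP; split; [|apply/memA]; lia.
have sum_b : \sum_(0 <= i < size A) (vanishing D w i - i%:Z)
    <= (\sum_(n <- A) gap [seq absz m | m <- A] (absz n))%N.
  apply: (@sum_vanishing_le _ _ D w A absz) => [|b b0].
    rewrite map_inj_in_uniq // => m n /memA[m0 _] /memA[n0 _]; lia.
  rewrite -size_filter; apply: (@has_card_size [set n | b <= n /\ tau n <= 0]).
  - by have := rk 0 b; rewrite /twist freegU0 addr0.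
  - exact: filter_uniq.
  - move=> n; rewrite mem_filter /=; split => [/andP[le_b /memA[n0 tn]]|[n0 tn]].
      by split=> //; lia.
    by apply/andP; split; [|apply/memA; split=> //]; lia.
rewrite sizeA /=.
have AB : (size A)%:Z * ((genus G)%:Z - deg D + rank D) <= ((size A) * (size B))%N.
  by rewrite PoszM ler_wpM2l //; lia.
rewrite subr_ge0 !lerBrDr; apply: le_trans (lerD (lerD sum_b sum_a) AB) _.
by rewrite -!PoszD lez_nat addnC (addnC (\sum_(n <- A) _)%N) addnA (leq_trans gaps).
Qed.
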